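(* There exist universal constants $c_3>0$ and $c_{\mathsf{lb}}>0$ such that the following holds. Let $3/4\le\gamma<1$ and let $T\ge\frac{c_3}{(1-\gamma)^2}$. There exists a $\gamma$-discounted MDP with $|\mathcal S|=4$ and $|\mathcal A|=2$ (rewards in $[0,1]$) such that synchronous Q-learning initialized at $Q_0\equiv0$ and run with either (i) learning rates $\eta_t=\frac{1}{1+c_\eta(1-\gamma)t}$ for all $t\ge0$, for any $c_\eta>0$, or (ii) constant learning rates $\eta_t\equiv\eta$ for any $\eta\in(0,1)$, satisfies $$\max_{s\in\mathcal S}\mathbb E\Big[\big|V_T(s)-V^\star(s)\big|^2\Big]\ge\frac{c_{\mathsf{lb}}}{(1-\gamma)^4T\log^2T}.$$
   Context: A discounted MDP $(\mathcal S,\mathcal A,P,r,\gamma)$ has finite state space $\mathcal S$, finite action space $\mathcal A$, transition kernel $P(\cdot\mid s,a)$, reward $r:\mathcal S\times\mathcal A\to[0,1]$ and discount $\gamma$; $Q^\star$ is the optimal Q-function and $V^\star(s)=\max_aQ^\star(s,a)$. Synchronous Q-learning: in each iteration $t=1,\dots,T$, for each $(s,a)$ an independent sample $s_t(s,a)\sim P(\cdot\mid s,a)$ is drawn (independent across pairs and iterations), and $Q_t(s,a)=(1-\eta_t)Q_{t-1}(s,a)+\eta_t\big(r(s,a)+\gamma\max_{a'}Q_{t-1}(s_t(s,a),a')\big)$; $V_t(s)=\max_aQ_t(s,a)$. The expectation is over the random samples. Logarithms are natural. *)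

(* Defs.v *)
From HB Require Import structures.
From mathcomp Require Import all_boot all_order all_algebra.
From mathcomp Require Import all_classical all_reals all_analysis.
Set Implicit Arguments. Unset Strict Implicit. Unset Printing Implicit Defensive.
Import Order.TTheory GRing.Theory Num.Theory.
Local Open Scope ring_scope.

Notation St := 'I_4.
Notation Act := 'I_2.

Section QL.
Variable R : realType.

Definition is_kernel (P : St -> Act -> St -> R) : Prop :=
  (forall s a s', 0 <= P s a s') /\ (forall s a, \sum_(s' : St) P s a s' = 1).

Definition rewards_in_01 (r : St -> Act -> R) : Prop :=
  forall s a, 0 <= r s a <= 1.

Definition vmax (Q : St -> Act -> R) (s : St) : R :=
  \big[Num.max/Q s ord0]_(a : Act) Q s a.

Definition smax (f : St -> R) : R :=
  \big[Num.max/f ord0]_(s : St) f s.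

(* Q^* : fixed point of the Bellman optimality operator (unique for gamma<1) *)
Definition bellman_opt (P : St -> Act -> St -> R) (r : St -> Act -> R)
  (gamma : R) (Q : St -> Act -> R) : Prop :=
  forall s a, Q s a = r s a + gamma * \sum_(s' : St) P s a s' * vmax Q s'.

(* A sample path of T iterations: for iteration t (1 <= t <= T, stored at
   ordinal t-1) and every pair (s,a), the sampled next state. *)
Definition path (T : nat) := {ffun 'I_T -> {ffun St * Act -> St}}.

Definition path_prob (P : St -> Act -> St -> R) (T : nat) (w : path T) : R :=
  \prod_(i : 'I_T) \prod_(sa : St * Act) P sa.1 sa.2 (w i sa).

(* sample s_t(s,a) of iteration t (1-based) *)
Definition sample (T : nat) (w : path T) (t : nat) (s : St) (a : Act) : St :=
  if @insub _ (fun i => i < T)%N _ t.-1 is Some i then w i (s, a) else s.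

Definition expect (P : St -> Act -> St -> R) (T : nat) (f : path T -> R) : R :=
  \sum_(w : path T) path_prob P w * f w.

Fixpoint qlearn (r : St -> Act -> R) (gamma : R) (eta : nat -> R)
  (T : nat) (w : path T) (t : nat) : St -> Act -> R :=
  match t with
  | O => fun _ _ => 0
  | t'.+1 => fun s a =>
      (1 - eta t) * qlearn r gamma eta w t' s a
      + eta t * (r s a + gamma * vmax (qlearn r gamma eta w t') (sample w t s a))
  end.

Definition max_mse (P : St -> Act -> St -> R) (r : St -> Act -> R) (gamma : R)
  (eta : nat -> R) (T : nat) (Qstar : St -> Act -> R) : R :=
  smax (fun s => expect P (fun w : path T =>
          (vmax (qlearn r gamma eta w T) s - vmax Qstar s) ^+ 2)).

End QL.

(* Main.v *)
(* Write h = 1 - gamma. State 3 is absorbing with reward 1, so its error after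
   T steps is exactly (1/h) prod_t (1 - h eta_t); this settles the matter when
   the learning rates are too small. In state 1 both actions have the same law
   and return to state 1 with probability 1 - 2q, with q of order
   h (2 + ln (1/h)). The gap D between the two Q-values there is a martingale
   transform contracting at rate 1 - eta, with E D^2 of order eta q / h^2 and
   E D^4 <= 24 (eta q / h^2)^2 + 2 eta^3 q / h^4, hence E |D| of order
   sqrt (E D^2) when eta <= q, and of order q / h otherwise. Since
   max x y = (x + y) / 2 + |x - y| / 2, each step adds about eta E |D| / 2 to the
   mean Q-value of state 1, and this overestimation accumulates over a horizon
   1 / q. When the error at state 3 is small, the
   final learning rate is at least of order 1 / (h T (2 + ln (1/h))), which
   makes the accumulated bias at least of order
   1 / (h^2 sqrt T (2 + ln (1/h))). *)
Require Import Defs.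
From HB Require Import structures.
From mathcomp Require Import all_boot all_order all_algebra.
From mathcomp Require Import all_classical all_reals all_analysis.
From mathcomp Require Import ring lra zify.
Set Implicit Arguments. Unset Strict Implicit. Unset Printing Implicit Defensive.
Import Order.TTheory GRing.Theory Num.Theory.
Local Open Scope ring_scope.

(** * Expectations over sample paths *)

Section Resampling.
Variables (R : comNzRingType) (I X : finType).

Definition update (w : {ffun I -> X}) (i : I) (x : X) : {ffun I -> X} :=
  [ffun j => if j == i then x else w j].

Lemma updateE w i x : update w i x i = x.
Proof. by rewrite ffunE eqxx. Qed.

Lemma update_neq w i x j : j != i -> update w i x j = w j.
Proof. by rewrite ffunE => /negbTE ->. Qed.

(** Exchanging coordinate [i] of [w] with a fresh value drawn from [mu i] is an involution that
    preserves the product weight. *)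
Lemma resample (mu : I -> X -> R) (i : I) (F : {ffun I -> X} -> R) :
  \sum_x mu i x = 1 ->
  \sum_(w : {ffun I -> X}) (\prod_j mu j (w j)) * F w =
  \sum_(w : {ffun I -> X}) (\prod_j mu j (w j)) * \sum_x mu i x * F (update w i x).
Proof.
move=> mu1.
under [RHS]eq_bigr do rewrite big_distrr /=.
rewrite pair_big /=.
pose swap (p : {ffun I -> X} * X) := (update p.1 i p.2, p.1 i).
have swapK : involutive swap.
  move=> [w x]; rewrite /swap /= updateE; congr (_, _).
  by apply/ffunP => j; rewrite !ffunE; case: eqP => // ->.
rewrite (reindex_inj (inv_inj swapK)) /=.
(* A factor of mass 1 is added on the left, so that both sides become sums over pairs, matched by
   [swap]. *)
have mulmu c : c = \sum_x c * mu i x by rewrite -big_distrr /= mu1 mulr1.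
under [LHS]eq_bigr do rewrite [_ * _]mulmu.
rewrite pair_big /=; apply: eq_bigr => -[w x] _ /=.
have -> : update (update w i x) i (w i) = w.
  by apply/ffunP => j; rewrite !ffunE; case: eqP => // ->.
rewrite (bigD1 i) //= [in RHS](bigD1 i) //= updateE.
have -> : \prod_(j | j != i) mu j (update w i x j) = \prod_(j | j != i) mu j (w j).
  by apply: eq_bigr => j /update_neq ->.
by ring.
Qed.

End Resampling.

Section Expectation.
Variables (R : realType) (P : St -> Act -> St -> R).
Hypothesis kerP : is_kernel P.

Lemma joint_sum1 : \sum_(x : {ffun St * Act -> St}) \prod_sa P sa.1 sa.2 (x sa) = 1.
Proof.
rewrite -(bigA_distr_bigA (fun sa s => P sa.1 sa.2 s)) big1 // => sa _.
exact: kerP.2.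
Qed.

Lemma path_prob_ge0 T (w : Defs.path T) : 0 <= path_prob P w.
Proof. by do 2![apply: prodr_ge0 => ? _]; exact: kerP.1. Qed.

Lemma path_prob_sum1 T : \sum_(w : Defs.path T) path_prob P w = 1.
Proof.
rewrite -(bigA_distr_bigA (fun=> fun x : {ffun St * Act -> St} =>
  \prod_sa P sa.1 sa.2 (x sa))) big1 // => i _.
exact: joint_sum1.
Qed.

Definition feasible T (w : Defs.path T) := forall i sa, P sa.1 sa.2 (w i sa) != 0.

Lemma path_prob_feasible T (w : Defs.path T) : path_prob P w != 0 -> feasible w.
Proof. by move=> /prodf_neq0 H i sa; have /prodf_neq0 -> := H i isT. Qed.

(** Infeasible paths have weight 0, so pathwise invariants are required only along transitions of
    nonzero probability. *)
Lemma expect_le T (f g : Defs.path T -> R) :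
  (forall w, feasible w -> f w <= g w) -> expect P f <= expect P g.
Proof.
move=> fg; apply: ler_sum => w _.
have [->|/path_prob_feasible sw] := eqVneq (path_prob P w) 0; first by rewrite !mul0r.
by apply: ler_wpM2l; [exact: path_prob_ge0 | exact: fg].
Qed.

Lemma expect_eq T (f g : Defs.path T -> R) :
  (forall w, feasible w -> f w = g w) -> expect P f = expect P g.
Proof. by move=> fg; apply/le_anti/andP; split; apply: expect_le => w /fg ->. Qed.

Lemma expect_cst T (c : R) : expect P (fun _ : Defs.path T => c) = c.
Proof. by rewrite /expect -big_distrl /= path_prob_sum1 mul1r. Qed.

Lemma expectD T (f g : Defs.path T -> R) :
  expect P (fun w => f w + g w) = expect P f + expect P g.
Proof. by rewrite /expect -big_split /=; apply: eq_bigr => w _; rewrite mulrDr. Qed.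

Lemma expectZ T (c : R) (f : Defs.path T -> R) :
  expect P (fun w => c * f w) = c * expect P f.
Proof. by rewrite /expect big_distrr /=; apply: eq_bigr => w _; rewrite mulrCA. Qed.

Lemma expect_ge0 T (f : Defs.path T -> R) : (forall w, feasible w -> 0 <= f w) -> 0 <= expect P f.
Proof. by move=> f0; rewrite -(expect_cst T 0); apply: expect_le. Qed.

(** Jensen's inequality for the square, which lies above its tangent line at the mean [m]. *)
Lemma expect_sqr_ge T (f : Defs.path T -> R) (c : R) :
  (expect P f - c) ^+ 2 <= expect P (fun w => (f w - c) ^+ 2).
Proof.
set m := expect P f.
have -> : (m - c) ^+ 2 = expect P (fun w => 2 * (m - c) * f w + (- (2 * (m - c) * m) + (m - c) ^+ 2)).
  by rewrite expectD expectZ expect_cst -/m; ring.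
apply: expect_le => w _; rewrite -subr_ge0.
by rewrite [leRHS](_ : _ = (f w - m) ^+ 2) ?sqr_ge0 //; ring.
Qed.

(** Since [F] does not read iteration [i], that iteration can be redrawn as a block, and then its
    entries at the distinct pairs [sa] and [sb] one by one. *)
Lemma expect_sample2 T (i : 'I_T) (sa sb : St * Act) (F : Defs.path T -> St -> St -> R) :
  sa != sb -> (forall w x, F (update w i x) = F w) ->
  expect P (fun w => F w (w i sa) (w i sb)) =
  expect P (fun w => \sum_s P sa.1 sa.2 s * \sum_s' P sb.1 sb.2 s' * F w s s').
Proof.
move=> sab Fi; rewrite /expect /path_prob.
pose nu (x : {ffun St * Act -> St}) := \prod_sa P sa.1 sa.2 (x sa).
rewrite (@resample _ _ _ (fun=> nu) i) ?joint_sum1 //=.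
apply: eq_bigr => w _; congr (_ * _).
under eq_bigr do rewrite Fi updateE.
rewrite (@resample _ _ _ (fun sa => P sa.1 sa.2) sa) ?(kerP.2 _ _) //=.
under eq_bigr do under [X in _ * X]eq_bigr do rewrite updateE update_neq 1?eq_sym //.
rewrite (@resample _ _ _ (fun sa => P sa.1 sa.2) sb) ?(kerP.2 _ _) //=.
under eq_bigr do under [X in _ * X]eq_bigr do under [X in _ * X]eq_bigr do rewrite updateE.
rewrite -big_distrl /= joint_sum1 mul1r.
under [LHS]eq_bigr do rewrite big_distrr /=.
by rewrite exchange_big /=; apply: eq_bigr => s _; rewrite big_distrr /=;
   apply: eq_bigr => s' _; ring.
Qed.

End Expectation.

(** * Recursions and learning rates *)

Section Scalars.
Variable R : realType.

(** A positive deficit y - x shrinks at least by the factor 1 - u0 per step, and (1 - u0) / (1 + z)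
    <= 1 / (1 + z + u0) turns this geometric decay into a rational bound. *)
Lemma relaxation_ge (x u : nat -> R) (y u0 : R) (m k : nat) :
  0 <= y -> 0 <= u0 -> 0 <= x m ->
  (forall t, (m <= t < m + k)%N ->
     u0 <= u t <= 1 /\ (1 - u t) * x t + u t * y <= x t.+1) ->
  y * (k%:R * u0 / (1 + k%:R * u0)) <= x (m + k)%N.
Proof.
move=> y0 u00 xm; elim: k => [|k IH] step; first by rewrite addn0 !mul0r mulr0.
have /IH {}IH : forall t, (m <= t < m + k)%N ->
    u0 <= u t <= 1 /\ (1 - u t) * x t + u t * y <= x t.+1.
  move=> t /andP[mt tk]; apply: step.
  by rewrite mt addnS ltnS ltnW.
have [|/andP[u0u u1] {}step] := step (m + k)%N.
  by rewrite leq_addr addnS /=.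
rewrite addnS; apply: le_trans step.
have k0 : 0 <= k%:R * u0 by rewrite mulr_ge0.
have fracE (z : R) : 0 <= z -> z / (1 + z) = 1 - (1 + z)^-1 by move=> z0; field; lra.
rewrite -natr1 !fracE // in IH *; last by nra.
set z := k%:R * u0 in k0 IH *.
have -> : (k%:R + 1) * u0 = z + u0 by rewrite /z; ring.
have zz : (1 - u0) / (1 + z) <= (1 + (z + u0))^-1.
  rewrite ler_pdivrMr; last by lra.
  rewrite mulrC ler_pdivlMr; last by lra.
  by nra.
have inv0 : 0 < (1 + z)^-1 by rewrite invr_gt0; lra.
set iz := (1 + z)^-1 in inv0 zz IH *.
set iz' := (1 + (z + u0))^-1 in zz *.
have H1 : (1 - u (m + k)%N) * (y * (1 - iz)) <= (1 - u (m + k)%N) * x (m + k)%N.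
  by apply: ler_wpM2l => //; lra.
have H2 : (1 - u (m + k)%N) * iz <= iz'.
  by apply: le_trans zz; apply: ler_wpM2r; lra.
by nra.
Qed.

(* With h = 1 - gamma, the error of Q-learning at a deterministic absorbing
   state is proportional to this product. *)
Definition decay (h : R) (eta : nat -> R) (t : nat) : R :=
  \prod_(i < t) (1 - h * eta i.+1).

Lemma decay0 h eta : decay h eta 0 = 1.
Proof. by rewrite /decay big_ord0. Qed.

Lemma decayS h eta t : decay h eta t.+1 = decay h eta t * (1 - h * eta t.+1).
Proof. by rewrite /decay big_ord_recr. Qed.

Lemma decay_bounds h eta t : 0 <= h <= 1 -> (forall t, 0 <= eta t <= 1) ->
  0 <= decay h eta t <= 1.
Proof.
move=> h01 eta01; elim: t => [|t IH]; first by rewrite decay0 ler01 lexx.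
have [/andP[e0 e1] /andP[h0 h1]] := (eta01 t.+1, h01).
have /andP[f0 f1] : 0 <= 1 - h * eta t.+1 <= 1 by apply/andP; split; nra.
by rewrite decayS; case/andP: IH => d0 d1; rewrite mulr_ge0 // mulr_ile1.
Qed.

Lemma decay_antitone h eta : 0 <= h <= 1 -> (forall t, 0 <= eta t <= 1) ->
  {homo decay h eta : m n / (m <= n)%N >-> n <= m}.
Proof.
move=> h01 eta01; apply: homo_leq => [x|x y z xy yz|t]; first exact: lexx.
  exact: le_trans yz xy.
have /andP[d0 _] := decay_bounds t h01 eta01.
have [/andP[e0 e1] /andP[h0 h1]] := (eta01 t.+1, h01).
by rewrite decayS ler_piMr //; nra.
Qed.

(** When the rates do not increase, the factors of a later window are the larger ones. *)
Lemma decay_supermul h eta m n : 0 <= h <= 1 -> (forall t, 0 <= eta t <= 1) ->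
  {homo eta : s t / (s <= t)%N >-> t <= s} ->
  decay h eta m * decay h eta n <= decay h eta (m + n).
Proof.
move=> h01 eta01 mono; elim: n => [|n IH]; first by rewrite decay0 mulr1 addn0.
have [/andP[e0 e1] /andP[h0 h1]] := (eta01 n.+1, h01).
rewrite addnS !decayS mulrA.
have /andP[dm0 _] := decay_bounds m h01 eta01.
have /andP[dn0 _] := decay_bounds n h01 eta01.
have le : eta (m + n).+1 <= eta n.+1 by apply: mono; rewrite ltnS leq_addl.
apply: ler_pM => //; [exact: mulr_ge0 | nra | nra].
Qed.

(** Since (1 - x) (1 + 4x/3) - 1 = x (1 - 4x) / 3, the slope 4/3 works exactly up to x = 1/4. *)
Lemma expR_le_1B (x : R) : 0 <= x <= 1 / 4 -> expR (- (4 / 3 * x)) <= 1 - x.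
Proof.
move=> /andP[x0 x1]; rewrite expRN.
have e1 := expR_ge1Dx (4 / 3 * x).
have e0 := expR_gt0 (4 / 3 * x).
rewrite -[leLHS]mul1r ler_pdivrMr //.
by nra.
Qed.

(** Each factor is at least exp(- 4/3 h eta), and the h eta sum to at most the integral ln(1 + l h
    t) / l. The parameter [l] lets one bound serve every larger [c]. *)
Lemma decay_linear_ge (h l c : R) t : 0 < h <= 1 / 4 -> 0 < l <= c ->
  expR (- (4 / 3 / l * ln (1 + l * h * t%:R))) <=
  decay h (fun i => 1 / (1 + c * h * i%:R)) t.
Proof.
move=> /andP[h0 h1] /andP[l0 lc]; elim: t => [|t IH].
  by rewrite decay0 mulr0 addr0 ln1 mulr0 oppr0 expR0.
rewrite decayS.
set eta := 1 / (1 + c * h * _).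
have t0 : 0 <= t%:R :> R by [].
have St : t.+1%:R = t%:R + 1 :> R by rewrite -natr1.
set x := 1 + l * h * t%:R in IH *.
set y := 1 + l * h * t.+1%:R.
have lh0 : 0 < l * h by exact: mulr_gt0.
have x1 : 1 <= x by rewrite /x; nra.
have yx : y = x + l * h by rewrite /y /x St; ring.
have y0 : 0 < y by lra.
have etay : eta <= 1 / y.
  rewrite /eta /y !div1r lef_pV2 ?posrE //; last first.
    by rewrite ltr_wpDr // !mulr_ge0 // ltW //; apply: lt_le_trans lc.
  by rewrite lerD2l ler_wpM2r // ler_wpM2r // ltW.
have eta0 : 0 <= eta.
  by rewrite /eta divr_ge0 // addr_ge0 // !mulr_ge0 // ltW //; apply: lt_le_trans lc.
have y1 : 1 / y <= 1 by rewrite ler_pdivrMr //; lra.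
have := @expR_le_1B (h * eta) _.
have -> : 0 <= h * eta <= 1 / 4 by apply/andP; split; nra.
move=> /(_ isT) H.
(* One step of the integral comparison, from ln(x / y) <= x / y - 1. *)
have lnstep : l * h / y <= ln y - ln x.
  have x0 : 0 < x by lra.
  have xy0 : 0 < x / y by rewrite divr_gt0.
  have := @le_ln1Dx R (x / y - 1); rewrite [1 + _]addrC subrK ln_div ?posrE //.
  have -> : l * h / y = 1 - x / y by rewrite yx; field; lra.
  by lra.
apply: (@le_trans _ _ (expR (- (4 / 3 / l * ln x)) * expR (- (4 / 3 * (h * eta))))).
  rewrite -expRD ler_expR.
  have hy : h * eta <= (ln y - ln x) / l.
    rewrite ler_pdivlMr //; apply: le_trans lnstep.
    have -> : h * eta * l = l * h * eta by ring.
    by move: etay; rewrite div1r => etay; rewrite ler_wpM2l // ltW.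
  have -> : 4 / 3 / l * ln y = 4 / 3 / l * ln x + 4 / 3 * ((ln y - ln x) / l).
    by field; lra.
  by lra.
by apply: ler_pM => //; rewrite expR_ge0.
Qed.

End Scalars.

(** After scaling by [a] this is u^2 - u^4 <= u: the left side is at most u when u <= 1 and
    nonpositive beyond. *)
Lemma norm_ge_quartic (R : realType) (a x : R) : 0 < a ->
  a^-1 * x ^+ 2 + - (a ^- 3) * x ^+ 4 <= `|x|.
Proof.
move=> a0; have -> : x ^+ 2 = `|x| ^+ 2 by rewrite real_normK ?num_real.
have -> : x ^+ 4 = `|x| ^+ 4 by rewrite -[4%N]/(2 * 2)%N !exprM real_normK ?num_real.
have : 0 <= `|x| by []; set z := `|x| => z0.
have zE : z = a * (z / a) by field; lra.
have : 0 <= z / a by rewrite divr_ge0 // ltW.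
set u := z / a in zE * => u0; rewrite zE.
have -> : a^-1 * (a * u) ^+ 2 + - (a ^- 3) * (a * u) ^+ 4 = a * (u ^+ 2 - u ^+ 4) by field; lra.
rewrite ler_pM2l //.
have [u1|u1] := leP u 1; first by have := exprn_ge0 4 u0; nra.
have : u ^+ 2 <= u ^+ 4 by rewrite ler_eXn2l.
by lra.
Qed.

(** Three phases: up to [n] the value of state 3 builds up, up to [n + n] the second moment of the
    gap, and then the bias. *)
Lemma quarter_split T : (8 <= T)%N ->
  exists n, [/\ (T <= n + n + (n + n))%N, (n + n + (n + n) <= T + 4)%N & (n + n <= T)%N].
Proof. by move=> T8; exists (T %/ 4).+1; split; lia. Qed.

(* The right-hand side is what bias_relax yields from expect_abs_gap_lower, with
   q = h l / 8; no attempt is made to optimize the constants. *)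
Lemma drift_level_ge (R : realType) (h l e t c rho : R) :
  0 < h -> 2 <= l -> 0 < e -> 0 < t -> 1 <= h ^+ 2 * t -> 1 <= 2 * e * h * t * l ->
  9 / 16 <= c -> 0 < rho -> rho <= h * l ->
  (2 ^+ 26 * (h ^+ 2 * l * Num.sqrt t))^-1 <=
  c * (e * (l / (8 * h)) /
    (512 * (64 * Num.sqrt (6 * (e * (l / (8 * h))) + e ^+ 2 / h ^+ 2)))) / rho * (1 / 44).
Proof.
move=> h0 l2 e0 t0 ht et c0 rho0 rhol.
have l0 : 0 < l by lra.
have hl0 : 0 < h * l by rewrite mulr_gt0.
set s := Num.sqrt t.
have s2 : s ^+ 2 = t by rewrite sqr_sqrtr // ltW.
have s0 : 0 < s by rewrite sqrtr_gt0.
set W := 6 * _ + _.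
have W0 : 0 < W.
  by apply: addr_gt0; [rewrite !mulr_gt0 // invr_gt0 mulr_gt0 | rewrite divr_gt0 // exprn_gt0].
(* Both terms of [W] are absorbed into (l e s)^2, the first by [et] and the second by [ht]. *)
have Ws : Num.sqrt W <= 2 * l * e * s.
  have p0 : 0 <= 2 * l * e * s by rewrite !mulr_ge0 // ltW.
  rewrite -[leRHS]ger0_norm // -sqrtr_sqr ler_wsqrtr //.
  have -> : (2 * l * e * s) ^+ 2 = 4 * (l ^+ 2 * (e ^+ 2 * t)) by rewrite -s2; ring.
  have W1 : 6 * (e * (l / (8 * h))) <= 3 / 2 * (l ^+ 2 * (e ^+ 2 * t)).
    have -> : 6 * (e * (l / (8 * h))) = 3 / 4 * (e * l / h) * 1 by field; lra.
    have -> : 3 / 2 * (l ^+ 2 * (e ^+ 2 * t)) = 3 / 4 * (e * l / h) * (2 * e * h * t * l).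
      by field; lra.
    apply: ler_wpM2l => //; apply: mulr_ge0; first by lra.
    by apply: divr_ge0; [apply: mulr_ge0|]; exact: ltW.
  have W2 : e ^+ 2 / h ^+ 2 <= e ^+ 2 * t.
    rewrite ler_pM2l ?exprn_gt0 // -[leLHS]mul1r ler_pdivrMr ?exprn_gt0 //.
    by rewrite mulrC.
  have W4 : 0 <= e ^+ 2 * t by rewrite mulr_ge0 ?sqr_ge0 // ltW.
  have W3 : e ^+ 2 * t <= l ^+ 2 * (e ^+ 2 * t).
    by rewrite -[leLHS]mul1r ler_wpM2r //; nra.
  by rewrite /W; lra.
have sW0 : 0 < Num.sqrt W by rewrite sqrtr_gt0.
have z0 : 0 < e * (l / (8 * h)) by rewrite !mulr_gt0 // invr_gt0 mulr_gt0.
have yl : 9 / 16 * (e * (l / (8 * h)) / (512 * (64 * (2 * l * e * s)))) / (h * l) <=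
    c * (e * (l / (8 * h)) / (512 * (64 * Num.sqrt W))) / rho.
  have les0 : 0 < 2 * l * e * s by rewrite !mulr_gt0.
  have den0 : 0 < 512 * (64 * (2 * l * e * s)) by lra.
  apply: ler_pM.
  - by apply: mulr_ge0; [lra | apply: divr_ge0; exact: ltW].
  - by rewrite invr_ge0 ltW.
  - apply: ler_pM; [lra | by apply: divr_ge0; exact: ltW | exact: c0 | ].
    by rewrite (ler_pM2l z0) lef_pV2 ?posrE; lra.
  - by rewrite lef_pV2 ?posrE.
have c44 : 0 <= 1 / 44 :> R by lra.
apply: le_trans (ler_wpM2r c44 yl).
have -> : 9 / 16 * (e * (l / (8 * h)) / (512 * (64 * (2 * l * e * s)))) / (h * l) * (1 / 44) =
   9 / 44 * (2 ^+ 23)^-1 * (h ^+ 2 * l * s)^-1 by field; lra.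
rewrite invfM ler_wpM2r //.
  by rewrite invr_ge0; apply: mulr_ge0; [apply: mulr_ge0; [exact: sqr_ge0|]|]; exact: ltW.
have i0 : 0 < (2 ^+ 23)^-1 :> R by rewrite invr_gt0 exprn_gt0.
have -> : 2 ^+ 26 = 2 ^+ 23 * 2 ^+ 3 :> R by rewrite -exprD.
rewrite invfM; set i := (2 ^+ 23)^-1 in i0 *.
have -> : (2 ^+ 3)^-1 = 1 / 8 :> R by rewrite !exprS expr0; field.
by lra.
Qed.

(** * The hard instance *)

Definition s0 : St := @Ordinal 4 0 isT.
Definition s1 : St := @Ordinal 4 1 isT.
Definition s2 : St := @Ordinal 4 2 isT.
Definition s3 : St := @Ordinal 4 3 isT.
Definition a0 : Act := @Ordinal 2 0 isT.
Definition a1 : Act := @Ordinal 2 1 isT.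

Lemma state_cases (Pr : St -> Prop) : Pr s0 -> Pr s1 -> Pr s2 -> Pr s3 -> forall s, Pr s.
Proof.
move=> p0 p1 p2 p3 [[|[|[|[|//]]]] lt].
- by rewrite (_ : Ordinal _ = s0) //; apply: val_inj.
- by rewrite (_ : Ordinal _ = s1) //; apply: val_inj.
- by rewrite (_ : Ordinal _ = s2) //; apply: val_inj.
- by rewrite (_ : Ordinal _ = s3) //; apply: val_inj.
Qed.

Ltac nonneg := by repeat (by [] || exact: ltW || apply: sqr_ge0 || apply: mulr_ge0).

Section Instance.
Variable R : realType.

Lemma sum_states (F : St -> R) : \sum_s F s = F s0 + F s1 + F s2 + F s3.
Proof.
rewrite !big_ord_recl big_ord0 addr0 !addrA.
by congr (F _ + F _ + F _ + F _); apply: val_inj.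
Qed.

Lemma vmaxE (Q : St -> Act -> R) s : vmax Q s = Num.max (Q s a0) (Q s a1).
Proof.
rewrite /vmax !big_ord_recl big_ord0.
have -> : lift ord0 ord0 = a1 by apply: val_inj.
have -> : ord0 = a0 by apply: val_inj.
by rewrite [Num.max (Q s a1) _]maxC maxA maxxx.
Qed.

Lemma le_smax (f : St -> R) s : f s <= smax f.
Proof. exact: le_bigmax. Qed.

(* State 1 is where both actions are noisy; it stays put, or jumps to the
   worthless state 0 or to the best state 3 with equal probability. State 2 is
   a spare. *)
Definition fork_kernel (q : R) (s : St) (a : Act) (s' : St) : R :=
  if s == s1 then
    if s' == s1 then 1 - 2 * q else if s' == s2 then 0 else q
  else (s' == s)%:R.

(** The reward 1/2 puts the optimal value of state 1 midway between those of states 0 and 3,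
    whatever [q] is. *)
Definition fork_reward (s : St) (a : Act) : R :=
  if s == s3 then 1 else if s == s1 then 1 / 2 else 0.

Lemma fork_kernelP q : 0 <= q <= 1 / 2 -> is_kernel (fork_kernel q).
Proof.
move=> /andP[q0 q1]; split=> [s a s'|s a].
  by rewrite /fork_kernel; repeat case: ifP => _ //; lra.
rewrite sum_states /fork_kernel.
by elim/state_cases: s => /=; ring.
Qed.

Lemma fork_reward01 : rewards_in_01 fork_reward.
Proof. by move=> s a; rewrite /fork_reward; repeat case: ifP => _ //; lra. Qed.

Definition fork_value (gamma : R) (s : St) : R :=
  if s == s3 then 1 / (1 - gamma) else if s == s1 then 1 / (2 * (1 - gamma)) else 0.

Lemma fork_bellman q gamma : gamma < 1 ->
  bellman_opt (fork_kernel q) fork_reward gamma (fun s _ => fork_value gamma s).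
Proof.
move=> g1 s a; rewrite sum_states !vmaxE !maxxx /fork_kernel /fork_reward /fork_value.
by elim/state_cases: s => /=; field; lra.
Qed.

(** Both actions have the same law and reward, so a fixed point ignores the action and solves a
    linear system: states 0 and 3 separately, then state 1. *)
Lemma fork_bellman_unique q gamma Q : 0 <= q <= 1 / 2 -> 0 < gamma < 1 ->
  bellman_opt (fork_kernel q) fork_reward gamma Q ->
  vmax Q s1 = 1 / (2 * (1 - gamma)) /\ vmax Q s3 = 1 / (1 - gamma).
Proof.
move=> /andP[q0 q1] /andP[g0 g1] bQ.
have Qa s : vmax Q s = Q s a0.
  rewrite vmaxE; suff -> : Q s a1 = Q s a0 by rewrite maxxx.
  by rewrite !bQ.
move: (bQ s0 a0) (bQ s1 a0) (bQ s3 a0).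
rewrite !Qa !sum_states !Qa /fork_kernel /fork_reward /=.
set x0 := Q s0 a0; set x1 := Q s1 a0; set x3 := Q s3 a0; set x2 := Q s2 a0 => b0 b1 b3.
have g10 : 1 - gamma != 0 by rewrite gt_eqF // subr_gt0.
have x00 : x0 = 0 by apply: (mulfI g10); lra.
have x3E : x3 = 1 / (1 - gamma) by rewrite -(mulfK g10 x3); congr (_ / _); lra.
split=> //.
have D0 : 1 - gamma * (1 - 2 * q) != 0 by rewrite gt_eqF //; nra.
apply: (mulfI D0).
have -> : (1 - gamma * (1 - 2 * q)) * x1 = 1 / 2 + gamma * q * x3.
  by rewrite x00 in b1; lra.
by rewrite x3E; field; lra.
Qed.

Variables (gamma q : R) (eta : nat -> R).
Hypothesis gamma_bounds : 3 / 4 <= gamma < 1.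
Hypothesis q_bounds : 0 < q <= 1 / 8.
Hypothesis eta_bounds : forall t, 0 < eta t <= 1.

Let h := 1 - gamma.
Let P := fork_kernel q.
Let kerP : is_kernel P.
Proof. by case/andP: q_bounds => q0 q1; apply: fork_kernelP; apply/andP; split; lra. Qed.
(** Closed form of the Q-value that state 3 has after [t] steps. *)
Let v t := (1 - decay h eta t) / h.

Let h_bounds : 0 < h <= 1 / 4.
Proof. by case/andP: gamma_bounds => g0 g1; apply/andP; rewrite /h; split; lra. Qed.

Let decay01 t : 0 <= decay h eta t <= 1.
Proof.
case/andP: h_bounds => h0 h1; apply: decay_bounds => [|i]; first by apply/andP; split; lra.
by case/andP: (eta_bounds i) => /ltW -> ->.
Qed.

Let v_step t : v t.+1 = (1 - eta t.+1) * v t + eta t.+1 * (1 + gamma * v t).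
Proof. by case/andP: gamma_bounds => g0 g1; rewrite /v decayS /h; field; lra. Qed.

Lemma fork_v_bounds t : 0 <= v t <= 1 / h.
Proof.
have /andP[d0 d1] := decay01 t; have /andP[h0 h1] := h_bounds.
rewrite /v; apply/andP; split; first by rewrite divr_ge0 //; lra.
by rewrite ler_pM2r ?invr_gt0 //; lra.
Qed.

(** * Pathwise behaviour of Q-learning on the instance *)

Section Paths.
Variable T : nat.
Implicit Types w : Defs.path T.
Let Qt w t := qlearn fork_reward gamma eta w t.
Let V w t := vmax (Qt w t).

Lemma sample_ord w (i : 'I_T) s a : sample w i.+1 s a = w i (s, a).
Proof. by rewrite /sample /= valK. Qed.

Lemma qlearn_step w (i : 'I_T) s a :
  Qt w i.+1 s a = (1 - eta i.+1) * Qt w i s a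
    + eta i.+1 * (fork_reward s a + gamma * V w i (w i (s, a))).
Proof. by rewrite -sample_ord. Qed.

(** Adaptedness: slot [i] holds iteration [i.+1], so the iterates up to time [i] do not see it. *)
Lemma qlearn_update w (i : 'I_T) x t : (t <= i)%N -> Qt (update w i x) t = Qt w t.
Proof.
elim: t => [//|t IH] ti; rewrite /Qt /= -!/(Qt _ _) IH ?(ltnW ti) //.
apply/funext => s; apply/funext => a.
have tT : (t < T)%N by apply: ltn_trans ti _.
have E w' := @sample_ord w' (Ordinal tT) s a; rewrite /= in E.
rewrite !E update_neq //.
by apply: contraTneq ti => <-; rewrite -leqNgt.
Qed.

Lemma feasible_sample w (i : 'I_T) s a : s != s1 -> feasible P w -> w i (s, a) = s.
Proof.
move=> ns /(_ i (s, a)) /=; rewrite /P /fork_kernel (negbTE ns).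
by case: (w i (s, a) =P s) => // _; rewrite eqxx.
Qed.

Lemma feasible_sample1 w (i : 'I_T) a : feasible P w -> w i (s1, a) != s2.
Proof.
move=> /(_ i (s1, a)) /=; rewrite /P /fork_kernel eqxx.
by case: (w i (s1, a) =P s2) => [->|//]; rewrite /= eqxx.
Qed.

(** State 1 stays between states 0 and 3 because its reward does and its feasible successors are 0,
    1 and 3. *)
Lemma qlearn_path_bounds w t : (t <= T)%N -> feasible P w ->
  [/\ forall a, Qt w t s0 a = 0, forall a, Qt w t s3 a = v t &
      forall a, 0 <= Qt w t s1 a <= v t].
Proof.
move=> + fw; elim: t => [_|t IH tT].
  have v0 : v 0 = 0 by rewrite /v decay0 subrr mul0r.
  by rewrite v0; split=> // a; rewrite lexx.
have [Q0 Q3 Q1] := IH (ltnW tT).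
pose i := Ordinal tT.
have e := eta_bounds t.+1.
have /andP[vt0 _] := fork_v_bounds t.
have V0 : V w t s0 = 0 by rewrite /V vmaxE !Q0 maxxx.
have V3 : V w t s3 = v t by rewrite /V vmaxE !Q3 maxxx.
have V1 : 0 <= V w t s1 <= v t.
  rewrite /V vmaxE; case/andP: (Q1 a0) => x0 x1; case/andP: (Q1 a1) => y0 y1.
  by rewrite le_max x0 ge_max x1 y1.
have step s a := @qlearn_step w i s a; rewrite /= in step.
split=> a; rewrite step.
- by rewrite feasible_sample // Q0 V0 /fork_reward /=; ring.
- by rewrite feasible_sample // Q3 V3 v_step.
have : 0 <= V w t (w i (s1, a)) <= v t.
  have := feasible_sample1 i a fw; elim/state_cases: (w i (s1, a)) => // _.
  - by rewrite V0 lexx.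
  - by rewrite V3 lexx vt0.
rewrite /fork_reward /= v_step.
set x := V w t _; have := Q1 a; set y := Qt w t _ _.
move: e gamma_bounds => /andP[e0 e1] /andP[g0 g1] /andP[y0 y1] /andP[x0 x1].
apply/andP; split.
  by rewrite addr_ge0 // mulr_ge0 //; try lra; rewrite addr_ge0 // ?mulr_ge0 //; lra.
rewrite lerD // ler_wpM2l //; try lra.
by rewrite lerD // ?ler_wpM2l //; lra.
Qed.

Lemma V_feasible w t : (t <= T)%N -> feasible P w ->
  [/\ V w t s0 = 0, V w t s3 = v t & 0 <= V w t s1 <= v t].
Proof.
move=> tT fw; have [Q0 Q3 Q1] := qlearn_path_bounds tT fw.
rewrite /V !vmaxE Q0 Q3 Q0 Q3 !maxxx; split=> //.
case/andP: (Q1 a0) => x0 x1; case/andP: (Q1 a1) => y0 y1.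
by rewrite le_max x0 ge_max x1 y1.
Qed.

(** * Moments of the gap and the bias *)

Definition gap w t := Qt w t s1 a0 - Qt w t s1 a1.
Definition mid w t := (Qt w t s1 a0 + Qt w t s1 a1) / 2.

Lemma V_mid_gap w t : V w t s1 = mid w t + `|gap w t| / 2.
Proof. by rewrite /V vmaxE maxr_absE /mid /gap; field. Qed.

(* The mean of F(V(s), V(s')) over two independent successors s, s' of state 1,
   where V(0) = 0, V(1) = y and V(3) = z. *)
Definition pair_mean (F : R -> R -> R) (y z : R) : R :=
  q ^+ 2 * (F 0 0 + F 0 z + F z 0 + F z z) +
  q * (1 - 2 * q) * (F 0 y + F y 0 + F y z + F z y) + (1 - 2 * q) ^+ 2 * F y y.

(** Averages out the two samples drawn at state 1 in iteration [t.+1], which are independent of the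
    iterate at time [t]. *)
Lemma expect_pair_mean t (F : Defs.path T -> R -> R -> R) (i : 'I_T) : i = t :> nat ->
  (forall w x, F (update w i x) = F w) ->
  expect P (fun w => F w (V w t (w i (s1, a0))) (V w t (w i (s1, a1)))) =
  expect P (fun w => pair_mean (F w) (V w t s1) (v t)).
Proof.
move=> it Fi.
rewrite (@expect_sample2 R P kerP T i (s1, a0) (s1, a1)
  (fun w s s' => F w (V w t s) (V w t s'))) //; last first.
  by move=> w x; apply/funext => s; apply/funext => s'; rewrite Fi /V qlearn_update ?it.
apply: expect_eq => // w fw.
have tT : (t <= T)%N by rewrite -it ltnW.
have [V0 V3 _] := V_feasible tT fw.
rewrite !sum_states V0 V3 /P /fork_kernel /= /pair_mean; ring.
Qed.

Lemma expect_gap_step (f : R -> R) t : (t < T)%N ->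
  expect P (fun w => f (gap w t.+1)) =
  expect P (fun w => pair_mean (fun x x' =>
    f ((1 - eta t.+1) * gap w t + eta t.+1 * gamma * (x - x'))) (V w t s1) (v t)).
Proof.
move=> tT; pose i := Ordinal tT.
rewrite -(@expect_pair_mean t (fun w x x' =>
    f ((1 - eta t.+1) * gap w t + eta t.+1 * gamma * (x - x'))) i) //; last first.
  by move=> w x; rewrite /gap qlearn_update.
apply: expect_eq => // w fw; congr f.
rewrite /gap; have step a := @qlearn_step w i s1 a; rewrite /= in step.
by rewrite !step /fork_reward /=; ring.
Qed.

Lemma expect_mid_step t : (t < T)%N ->
  expect P (fun w => mid w t.+1) =
  (1 - eta t.+1) * expect P (fun w => mid w t) + eta t.+1 * (1 / 2 +
    gamma * ((1 - 2 * q) * expect P (fun w => V w t s1) + q * v t)).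
Proof.
move=> tT; pose i := Ordinal tT.
have -> : expect P (fun w => mid w t.+1) = expect P (fun w => pair_mean (fun x x' =>
    (1 - eta t.+1) * mid w t + eta t.+1 * (1 / 2 + gamma * ((x + x') / 2)))
    (V w t s1) (v t)).
  rewrite -(@expect_pair_mean t (fun w x x' =>
      (1 - eta t.+1) * mid w t + eta t.+1 * (1 / 2 + gamma * ((x + x') / 2))) i) //; last first.
    by move=> w x; rewrite /mid qlearn_update.
  apply: expect_eq => // w fw.
  rewrite /mid; have step a := @qlearn_step w i s1 a; rewrite /= in step.
  by rewrite !step /fork_reward /=; field.
transitivity (expect P (fun w => (1 - eta t.+1) * mid w t +
    (eta t.+1 * gamma * (1 - 2 * q) * V w t s1 + eta t.+1 * (1 / 2 + gamma * q * v t)))).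
  by apply: expect_eq => // w fw; rewrite /pair_mean; field.
by rewrite !expectD !expectZ expect_cst //; ring.
Qed.

(** Second and fourth moments of X - X', where X and X' are independent copies of the value at the
    successor of state 1. *)
Let X2 y z := 2 * q * ((1 - 2 * q) * (y ^+ 2 + (z - y) ^+ 2) + q * z ^+ 2).
Let X4 y z := 2 * q * ((1 - 2 * q) * (y ^+ 4 + (z - y) ^+ 4) + q * z ^+ 4).

(** The sum y^2 + (z - y)^2 lies between z^2 / 2 and z^2, so the bounds are uniform in the random
    value [y]. *)
Let X2_bounds y z : 0 <= y <= z -> q * z ^+ 2 <= X2 y z <= 2 * q * z ^+ 2.
Proof.
move=> /andP[y0 yz]; case/andP: q_bounds => q0 q1.
have lo : z ^+ 2 / 2 <= y ^+ 2 + (z - y) ^+ 2.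
  by have := sqr_ge0 (2 * y - z); nra.
have hi : y ^+ 2 + (z - y) ^+ 2 <= z ^+ 2 by nra.
rewrite /X2; set N := _ + _ in lo hi *; set Z := z ^+ 2 in lo hi *.
have Z0 : 0 <= Z by apply: sqr_ge0.
have L : (1 - 2 * q) * (Z / 2) <= (1 - 2 * q) * N by apply: ler_wpM2l => //; lra.
have H : (1 - 2 * q) * N <= (1 - 2 * q) * Z by apply: ler_wpM2l => //; lra.
by apply/andP; split; nra.
Qed.

(** The difference X - X' is at most [z] in absolute value. *)
Let X4_le y z : 0 <= y <= z -> X4 y z <= z ^+ 2 * X2 y z.
Proof.
move=> /andP[y0 yz]; case/andP: q_bounds => q0 q1; rewrite -subr_ge0.
have -> : z ^+ 2 * X2 y z - X4 y z = 2 * q * (1 - 2 * q) *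
   (y ^+ 2 * ((z - y) * (z + y)) + (z - y) ^+ 2 * (y * (2 * z - y))).
  by rewrite /X2 /X4; ring.
by rewrite mulr_ge0 ?addr_ge0 ?mulr_ge0 ?sqr_ge0 //; lra.
Qed.

(** The cross term vanishes since X - X' is symmetric. *)
Lemma expect_gap2_step t : (t < T)%N ->
  expect P (fun w => gap w t.+1 ^+ 2) = (1 - eta t.+1) ^+ 2 * expect P (fun w => gap w t ^+ 2)
    + (eta t.+1 * gamma) ^+ 2 * expect P (fun w => X2 (V w t s1) (v t)).
Proof.
move=> tT; rewrite -!expectZ -expectD (expect_gap_step (fun x => x ^+ 2) tT).
by apply: expect_eq => // w fw; rewrite /pair_mean /X2; ring.
Qed.

Lemma expect_gap2_ge t : (t < T)%N ->
  (1 - eta t.+1) ^+ 2 * expect P (fun w => gap w t ^+ 2)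
    + eta t.+1 ^+ 2 * (gamma ^+ 2 * q * v t ^+ 2) <= expect P (fun w => gap w t.+1 ^+ 2).
Proof.
move=> tT; rewrite expect_gap2_step // lerD2l.
have : q * v t ^+ 2 <= expect P (fun w => X2 (V w t s1) (v t)).
  rewrite -(expect_cst kerP T (q * v t ^+ 2)); apply: expect_le => // w fw.
  by have [_ _ /X2_bounds/andP[]] := V_feasible (ltnW tT) fw.
move=> /(ler_wpM2l (sqr_ge0 (eta t.+1 * gamma))); apply: le_trans.
by rewrite le_eqVlt; apply/orP; left; apply/eqP; ring.
Qed.

Let Q := q / h ^+ 2.

Let X2_le w t : (t <= T)%N -> feasible P w -> X2 (V w t s1) (v t) <= 2 * Q.
Proof.
move=> tT fw; have [_ _ /X2_bounds/andP[_]] := V_feasible tT fw.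
move=> /le_trans; apply; case/andP: q_bounds => q0 q1; case/andP: h_bounds => h0 h1.
rewrite /Q mulrA ler_wpM2l //; first by lra.
have /andP[v0 v1] := fork_v_bounds t.
by rewrite -exprVn -div1r lerXn2r ?nnegrE // divr_ge0 // ltW.
Qed.

(* Keeps E D_t^2 of the order of the current learning rate: the memory of the
   early, larger rates is forgotten fast enough. *)
Hypothesis eta_slow : forall t, (1 - eta t.+1) * eta t <= eta t.+1.

(** With e the new rate, [eta_slow] closes the induction: (1 - e)^2 eta_t + e^2 <= (1 - e) e + e^2 =
    e. *)
Lemma expect_gap2_le t : (t <= T)%N -> expect P (fun w => gap w t ^+ 2) <= 2 * eta t * Q.
Proof.
case/andP: q_bounds => q0 q1; case/andP: h_bounds => h0 h1.
have Q0 : 0 < Q by rewrite divr_gt0 // exprn_gt0.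
elim: t => [_|t IH tT].
  have -> : (fun w : Defs.path T => gap w 0 ^+ 2) = fun=> 0.
    by apply/funext => w; rewrite /gap /Qt /= subr0 expr0n.
  by rewrite expect_cst //; case/andP: (eta_bounds 0%N) => e0 _; apply: mulr_ge0; [rewrite mulr_ge0 // ltW | exact: ltW].
rewrite expect_gap2_step //.
have X : expect P (fun w => X2 (V w t s1) (v t)) <= 2 * Q.
  rewrite -(expect_cst kerP T (2 * Q)); apply: expect_le => // w fw.
  exact: X2_le (ltnW tT) fw.
have {}IH := IH (ltnW tT).
case/andP: gamma_bounds => g0 g1; case/andP: (eta_bounds t.+1) => e0 e1.
have es := eta_slow t.
set e := eta t.+1 in es e0 e1 *; set S := expect P _ in IH *; set Y := expect P _ in X *.
have H1 : (1 - e) ^+ 2 * S <= (1 - e) ^+ 2 * (2 * eta t * Q) by rewrite ler_wpM2l ?sqr_ge0.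
have H2 : (e * gamma) ^+ 2 * Y <= e ^+ 2 * (2 * Q).
  apply: (@le_trans _ _ ((e * gamma) ^+ 2 * (2 * Q))); first by rewrite ler_wpM2l ?sqr_ge0.
  rewrite ler_wpM2r //; first by lra.
  by rewrite lerXn2r ?nnegrE //; nra.
have H3 : (1 - e) * ((1 - e) * eta t) <= (1 - e) * e by rewrite ler_wpM2l //; lra.
have H4 := ler_wpM2r (ltW Q0) H3.
by nra.
Qed.

(* The odd moments of the noise vanish by symmetry, so that
   E (x + n)^4 = x^4 + 6 x^2 E n^2 + E n^4. *)
Lemma expect_gap4_le t : (t <= T)%N ->
  expect P (fun w => gap w t ^+ 4) <= 24 * (eta t * Q) ^+ 2 + 2 * eta t ^+ 3 * (Q / h ^+ 2).
Proof.
case/andP: q_bounds => q0 q1; case/andP: h_bounds => h0 h1.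
have Q0 : 0 < Q by rewrite divr_gt0 // exprn_gt0.
set Q' := Q / h ^+ 2; have Q'0 : 0 < Q' by rewrite divr_gt0 // exprn_gt0.
elim: t => [_|t IH tT].
  have -> : (fun w : Defs.path T => gap w 0 ^+ 4) = fun=> 0.
    by apply/funext => w; rewrite /gap /Qt /= subr0 expr0n.
  rewrite expect_cst //; case/andP: (eta_bounds 0%N) => e0 _.
  apply: addr_ge0; first by rewrite mulr_ge0 // sqr_ge0.
  by apply: mulr_ge0; [rewrite mulr_ge0 // exprn_ge0 // ltW | exact: ltW].
have {}IH := IH (ltnW tT).
have S2 := expect_gap2_le (ltnW tT).
case/andP: gamma_bounds => g0 g1; case/andP: (eta_bounds t.+1) => e0 e1.
have es := eta_slow t; have et0 : 0 < eta t by case/andP: (eta_bounds t).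
set e := eta t.+1 in es e0 e1 *.
set M := expect P (fun w => gap w t ^+ 4) in IH *.
set S := expect P (fun w => gap w t ^+ 2) in S2 *.
have step : expect P (fun w => gap w t.+1 ^+ 4) <=
    (1 - e) ^+ 4 * M + 12 * (1 - e) ^+ 2 * e ^+ 2 * Q * S + e ^+ 4 * (2 * Q').
  rewrite -(expect_cst kerP T (e ^+ 4 * (2 * Q'))) /M /S -!expectZ -!expectD.
  rewrite (expect_gap_step (fun x => x ^+ 4) tT) -/e; apply: expect_le => // w fw.
  have [_ _ Vb] := V_feasible (ltnW tT) fw.
  have X2le := X2_le (ltnW tT) fw.
  have X4le := X4_le Vb.
  have /andP[X2ge _] := X2_bounds Vb.
  have vh : v t ^+ 2 <= (h ^+ 2)^-1.
    have /andP[v0 v1] := fork_v_bounds t.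
    by rewrite -exprVn -div1r lerXn2r ?nnegrE // divr_ge0 // ltW.
  have v20 : 0 <= v t ^+ 2 by exact: sqr_ge0.
  set y := V w t s1 in X2le X4le X2ge *; set z := v t in X2le X4le X2ge vh v20 *.
  have -> : pair_mean (fun x x' => ((1 - e) * gap w t + e * gamma * (x - x')) ^+ 4) y z =
     (1 - e) ^+ 4 * gap w t ^+ 4 + 6 * (1 - e) ^+ 2 * (e * gamma) ^+ 2 * gap w t ^+ 2 * X2 y z
     + (e * gamma) ^+ 4 * X4 y z by rewrite /pair_mean /X2 /X4; ring.
  have X20 : 0 <= X2 y z by apply: le_trans X2ge; rewrite mulr_ge0 // ltW.
  have X4le' : X4 y z <= 2 * Q'.
    apply: le_trans X4le _; apply: (@le_trans _ _ ((h ^+ 2)^-1 * (2 * Q))).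
      by apply: ler_pM.
    by rewrite /Q' mulrC mulrA.
  have eg : e * gamma <= e by rewrite ler_piMr //; lra.
  have eg0 : 0 <= e * gamma by rewrite mulr_ge0 //; lra.
  have eg2 : (e * gamma) ^+ 2 <= e ^+ 2 by rewrite lerXn2r ?nnegrE // ltW.
  have eg4 : (e * gamma) ^+ 4 <= e ^+ 4 by rewrite lerXn2r ?nnegrE // ltW.
  rewrite -!addrA lerD2l; apply: lerD.
    rewrite [leRHS](_ : _ = 6 * (1 - e) ^+ 2 * e ^+ 2 * gap w t ^+ 2 * (2 * Q)); last by ring.
    apply: ler_pM => //; first nonneg.
    rewrite ler_wpM2r ?sqr_ge0 // ler_wpM2l //; nonneg.
  apply: (@le_trans _ _ ((e * gamma) ^+ 4 * (2 * Q'))); first by rewrite ler_wpM2l ?exprn_ge0.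
  by rewrite ler_wpM2r //; lra.
apply: le_trans step _.
set f := 1 - e in es *; have f0 : 0 <= f by rewrite /f; lra.
set p := f * eta t in es; have p0 : 0 <= p by rewrite mulr_ge0 // ltW.
have H1 : f ^+ 4 * M <= 24 * (f * p * Q) ^+ 2 + 2 * f * p ^+ 3 * Q'.
  have := ler_wpM2l (exprn_ge0 4 f0) IH; rewrite /p; move/le_trans; apply.
  by rewrite le_eqVlt; apply/orP; left; apply/eqP; ring.
have H2 : 12 * f ^+ 2 * e ^+ 2 * Q * S <= 24 * f * e ^+ 2 * p * Q ^+ 2.
  have c0 : 0 <= 12 * f ^+ 2 * e ^+ 2 * Q by nonneg.
  have := ler_wpM2l c0 S2; rewrite /p; move/le_trans; apply.
  by rewrite le_eqVlt; apply/orP; left; apply/eqP; ring.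
have p2 : p ^+ 2 <= e ^+ 2 by rewrite lerXn2r ?nnegrE // ltW.
have p3 : p ^+ 3 <= e ^+ 3 by rewrite lerXn2r ?nnegrE // ltW.
have H3 : 24 * (f * p * Q) ^+ 2 <= 24 * f * (e * Q) ^+ 2 * f.
  rewrite [leLHS](_ : _ = 24 * (f * Q) ^+ 2 * p ^+ 2); last by ring.
  rewrite [leRHS](_ : _ = 24 * (f * Q) ^+ 2 * e ^+ 2); last by ring.
  rewrite ler_wpM2l //; nonneg.
have H4 : 24 * f * e ^+ 2 * p * Q ^+ 2 <= 24 * f * (e * Q) ^+ 2 * e.
  rewrite [leLHS](_ : _ = 24 * f * (e * Q) ^+ 2 * p); last by ring.
  rewrite ler_wpM2l //; nonneg.
have H5 : 2 * f * p ^+ 3 * Q' <= 2 * f * e ^+ 3 * Q'.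
  rewrite ler_wpM2r //; first exact: ltW.
  rewrite ler_wpM2l //; nonneg.
have H6 : 24 * f * (e * Q) ^+ 2 <= 24 * (e * Q) ^+ 2.
  by rewrite ler_wpM2r ?sqr_ge0 // /f; lra.
(* As f + e = 1, the recursion reproduces its own form. The 24 is 6 * 2 * 2: the binomial
   coefficient, [X2_le] and [expect_gap2_le]. *)
have E1 : 24 * f * (e * Q) ^+ 2 * f + 24 * f * (e * Q) ^+ 2 * e = 24 * f * (e * Q) ^+ 2.
  by rewrite /f; ring.
have E2 : 2 * f * e ^+ 3 * Q' + e ^+ 4 * (2 * Q') = 2 * e ^+ 3 * Q' by rewrite /f; ring.
by lra.
Qed.

(* In the absence of noise the value of state 1 is half that of state 3. *)
Definition bias t := expect P (fun w => mid w t) - v t / 2.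

(** Subtracting half the recursion of [v] cancels the rewards and the jumps. What remains contracts
    at rate eta (h + 2 gamma q) and is driven by the overestimation of the maximum. *)
Lemma bias_step t : (t < T)%N ->
  bias t.+1 = (1 - eta t.+1 * (1 - gamma * (1 - 2 * q))) * bias t +
    eta t.+1 * (gamma * (1 - 2 * q) * (expect P (fun w => `|gap w t|) / 2)).
Proof.
move=> tT; rewrite /bias expect_mid_step // v_step.
have -> : expect P (fun w => V w t s1) = expect P (fun w => mid w t) +
    expect P (fun w => `|gap w t|) / 2.
  rewrite [X in _ = _ + X]mulrC -expectZ -expectD; apply: expect_eq => // w _.
  by rewrite V_mid_gap [2^-1 * _]mulrC.
by field.
Qed.

(* A fourth-moment substitute for Hoelder's inequality that only needs a lower
   bound on the second moment and an upper bound on the fourth. *)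
Lemma expect_abs_ge t (c d a : R) : 0 < a ->
  c <= expect P (fun w => gap w t ^+ 2) -> expect P (fun w => gap w t ^+ 4) <= d ->
  (c - d / a ^+ 2) / a <= expect P (fun w => `|gap w t|).
Proof.
move=> apos cS Md.
have Hexp : expect P (fun w => a^-1 * gap w t ^+ 2 + - (a ^- 3) * gap w t ^+ 4) <=
    expect P (fun w => `|gap w t|).
  apply: expect_le => // w _; exact: norm_ge_quartic.
apply: le_trans Hexp; rewrite expectD !expectZ.
have i1 : 0 <= a^-1 by rewrite invr_ge0 ltW.
have i3 : 0 <= a ^- 3 by rewrite invr_ge0 exprn_ge0 // ltW.
have -> : (c - d / a ^+ 2) / a = a^-1 * c - a ^- 3 * d by field; lra.
by rewrite mulNr lerB // ler_wpM2l.
Qed.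

(** * Lower bounds on the gap and on the bias *)

Hypothesis eta_antitone : {homo eta : s t / (s <= t)%N >-> t <= s}.

Let v_ge n t : decay h eta n <= 1 / 2 -> (n <= t)%N -> (2 * h)^-1 <= v t.
Proof.
case/andP: h_bounds => h0 h1 dn nt.
have dt : decay h eta t <= decay h eta n.
  apply: decay_antitone => // [|i]; first by apply/andP; split; lra.
  by case/andP: (eta_bounds i) => /ltW -> ->.
rewrite /v invfM ler_pM2r ?invr_gt0 //; lra.
Qed.

Lemma expect_gap2_lower n t : decay h eta n <= 1 / 2 -> 1 / 8 <= n%:R * eta T ->
  (n + n <= t <= T)%N -> eta T * Q / 128 <= expect P (fun w => gap w t ^+ 2).
Proof.
case/andP: h_bounds => h0 h1; case/andP: gamma_bounds => g0 g1.
case/andP: q_bounds => q0 q1 dn nT /andP[nt tT].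
have Q0 : 0 < Q by rewrite divr_gt0 // exprn_gt0.
have /andP[e0 e1] := eta_bounds T.
have nt' : (n <= t)%N by apply: leq_trans nt; rewrite leq_addr.
have eQ0 : 0 < eta T * Q by rewrite mulr_gt0.
(* The 9/64 is (3/4)^2 / 4, from gamma >= 3/4 and v >= 1 / (2h). *)
have G : 9 / 64 * Q <= gamma ^+ 2 * q * (2 * h)^-1 ^+ 2.
  have -> : gamma ^+ 2 * q * (2 * h)^-1 ^+ 2 = gamma ^+ 2 / 4 * Q by rewrite /Q; field; lra.
  by rewrite ler_pM2r //; nra.
(* The relaxation weight is e (2 - e) because (1 - e)^2 = 1 - e (2 - e); the halved target then
   costs at most e^2 * 9/64 * Q, as eta T <= e. *)
have := @relaxation_ge R (fun t => expect P (fun w => gap w t ^+ 2))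
  (fun t => eta t.+1 * (2 - eta t.+1)) (eta T * (9 / 64 * Q) / 2) (eta T) n (t - n) _ _ _ _.
have -> : 0 <= eta T * (9 / 64 * Q) / 2 by lra.
have -> : 0 <= expect P (fun w => gap w n ^+ 2).
  by apply: expect_ge0 => // w _; exact: sqr_ge0.
rewrite ltW // subnKC // => H; move: {H}(H isT isT isT) => H.
apply: le_trans (H _); last first.
  move=> i /andP[ni it]; have iT : (i < T)%N by apply: leq_trans tT.
  have ei : eta T <= eta i.+1 by apply: eta_antitone.
  have /andP[f0 f1] := eta_bounds i.+1.
  split; first by apply/andP; split; nra.
  have := expect_gap2_ge iT.
  set S := expect P (fun w => gap w i ^+ 2) => /(le_trans _); apply.
  have -> : (1 - eta i.+1 * (2 - eta i.+1)) = (1 - eta i.+1) ^+ 2 by ring.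
  rewrite lerD2l.
  have vv : (2 * h)^-1 ^+ 2 <= v i ^+ 2.
    have hv := v_ge dn ni.
    have i0 : 0 <= (2 * h)^-1 by rewrite invr_ge0 mulr_ge0 // ltW.
    by rewrite lerXn2r // nnegrE //; exact: le_trans hv.
  have G' : 9 / 64 * Q <= gamma ^+ 2 * q * v i ^+ 2.
    apply: le_trans G _; rewrite ler_wpM2l //.
    by apply: mulr_ge0; [exact: sqr_ge0 | exact: ltW].
  apply: (@le_trans _ _ (eta i.+1 ^+ 2 * (9 / 64 * Q))); last by rewrite ler_wpM2l ?sqr_ge0.
  have : eta i.+1 * (2 - eta i.+1) * eta T <= 2 * eta i.+1 ^+ 2 by nra.
  move=> /(ler_wpM2r (ltW Q0)); lra.
have kn : n%:R <= (t - n)%:R :> R by rewrite ler_nat leq_subRL.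
set k := (t - n)%:R in kn *.
have ku : 1 / 8 <= k * eta T by apply: le_trans nT _; rewrite ler_wpM2r // ltW.
have : 1 / 9 <= k * eta T / (1 + k * eta T) by rewrite ler_pdivlMr; lra.
by move=> /(ler_wpM2l (ltW eQ0)); lra.
Qed.

(** Both the contraction factor and the drift in [bias_step] are nonnegative. *)
Lemma bias_ge0 t : (t <= T)%N -> 0 <= bias t.
Proof.
case/andP: h_bounds => h0 h1; case/andP: gamma_bounds => g0 g1.
case/andP: q_bounds => q0 q1.
elim: t => [_|t IH tT].
  rewrite /bias; have -> : (fun w : Defs.path T => mid w 0) = fun=> 0.
    by apply/funext => w; rewrite /mid /Qt /= addr0 mul0r.
  by rewrite expect_cst // /v decay0 subrr !mul0r subrr.
rewrite bias_step //; have /andP[e0 e1] := eta_bounds t.+1.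
have A0 : 0 <= expect P (fun w => `|gap w t|) by apply: expect_ge0.
have {}IH := IH (ltnW tT).
have r1 : gamma * (1 - 2 * q) <= 1 by nra.
have r0 : 0 <= gamma * (1 - 2 * q) by apply: mulr_ge0; lra.
apply: addr_ge0; first by apply: mulr_ge0 => //; nra.
apply: mulr_ge0; first exact: ltW.
by apply: mulr_ge0 => //; lra.
Qed.

Lemma expect_abs_gap_lower n t : decay h eta n <= 1 / 2 -> 1 / 8 <= n%:R * eta T ->
  (n + n <= t <= T)%N -> eta t <= 2 * eta T ->
  eta T * Q / (256 * (64 * Num.sqrt (6 * (eta T * Q) + eta T ^+ 2 / h ^+ 2))) <=
  expect P (fun w => `|gap w t|).
Proof.
move=> dn nT1 nt et; case/andP: h_bounds => h0 _; case/andP: q_bounds => q0 _.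
have /andP[e0 _] := eta_bounds T; have /andP[et0 _] := eta_bounds t.
have S := expect_gap2_lower dn nT1 nt; case/andP: nt => nt tT.
have := expect_gap4_le tT.
have Q0 : 0 < Q by rewrite divr_gt0 // exprn_gt0.
move: (Q) Q0 S => X X0 S M.
have eX0 : 0 < eta T * X by rewrite mulr_gt0.
have [W WE] : exists W, W = 6 * (eta T * X) + eta T ^+ 2 / h ^+ 2 by eexists.
have W0 : 0 < W.
  by rewrite WE; apply: addr_gt0; [rewrite mulr_gt0 | rewrite divr_gt0 // exprn_gt0].
rewrite -WE.
(* With this scale the fourth-moment correction is 16/4096 = 1/256 of [eta T * X], half of the
   second-moment bound 1/128. *)
have a0 : 0 < 64 * Num.sqrt W by rewrite mulr_gt0 // sqrtr_gt0.
have a2 : (64 * Num.sqrt W) ^+ 2 = 4096 * W by rewrite exprMn sqr_sqrtr ?ltW //; ring.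
have {}M : expect P (fun w => gap w t ^+ 4) <= 16 * (eta T * X) * W.
  apply: le_trans M _.
  have -> : 16 * (eta T * X) * W =
      24 * (2 * eta T * X) ^+ 2 + 2 * (2 * eta T) ^+ 3 * (X / h ^+ 2).
    by rewrite WE; field; rewrite gt_eqF.
  have i2 : 0 <= X / h ^+ 2 by rewrite ltW // divr_gt0 // exprn_gt0.
  have e20 : 0 <= 2 * eta T by rewrite mulr_ge0 // ltW.
  apply: lerD.
    rewrite ler_wpM2l // lerXn2r ?nnegrE //.
    - by rewrite mulr_ge0 // ltW.
    - by rewrite mulr_ge0 // ltW.
    by rewrite ler_wpM2r // ltW.
  rewrite ler_wpM2r // ler_wpM2l // lerXn2r ?nnegrE //.
  exact: ltW.
apply: le_trans (expect_abs_ge a0 S M); rewrite a2.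
rewrite le_eqVlt; apply/orP; left; apply/eqP; field.
by apply/andP; split; rewrite gt_eqF // sqrtr_gt0.
Qed.

Lemma bias_relax n (d rho : R) : rho = 1 - gamma * (1 - 2 * q) -> 0 < rho <= 1 -> 0 <= d ->
  (n <= T)%N ->
  (forall t, (n <= t <= T)%N -> 2 * d <= expect P (fun w => `|gap w t|)) ->
  3 / 128 <= (T - n)%:R * (eta T * rho) ->
  gamma * (1 - 2 * q) * d / rho * (1 / 44) <= bias T.
Proof.
case/andP: gamma_bounds => g0 _; case/andP: q_bounds => _ q1.
move=> rhoE /andP[rho0 rho1] d0 nT absgap kU.
have /andP[e0 _] := eta_bounds T.
have c0 : 0 <= gamma * (1 - 2 * q) by apply: mulr_ge0; lra.
have y0 : 0 <= gamma * (1 - 2 * q) * d / rho.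
  by apply: divr_ge0; [apply: mulr_ge0 | exact: ltW].
have u0 : 0 <= eta T * rho by rewrite mulr_ge0 // ltW.
have := @relaxation_ge R bias (fun t => eta t.+1 * rho) _ (eta T * rho) n (T - n)
  y0 u0 (bias_ge0 nT) _.
rewrite subnKC // => H; apply: le_trans (H _); last first.
  move=> t /andP[nt tT].
  have et : eta T <= eta t.+1 by apply: eta_antitone.
  have /andP[f0 f1] := eta_bounds t.+1.
  split.
    apply/andP; split; first by rewrite ler_wpM2r // ltW.
    by rewrite mulr_ile1 // ltW.
  rewrite bias_step // -rhoE lerD2l.
  have -> : eta t.+1 * rho * (gamma * (1 - 2 * q) * d / rho) =
      eta t.+1 * (gamma * (1 - 2 * q) * d) by field; rewrite gt_eqF.
  have g := absgap t; rewrite nt ltnW // in g; have {}g := g isT.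
  rewrite ler_wpM2l //; first exact: ltW.
  by rewrite ler_wpM2l // ler_pdivlMr // mulrC.
apply: ler_wpM2l => //.
move: kU; set U := (T - n)%:R * _ => kU.
(* At U = 3/128 the fraction is 3/131, just above 1/44. *)
by rewrite ler_pdivlMr; lra.
Qed.

Lemma bias_lower (l : R) : 2 <= l -> h * l <= 1 -> q = h * l / 8 ->
  (8 <= T)%N -> 1 <= h ^+ 2 * T%:R ->
  1 <= 2 * eta T * h * T%:R * l ->
  (forall t, (T <= t + t)%N -> eta t <= 2 * eta T) ->
  decay h eta T <= 1 / 16 ->
  (2 ^+ 26 * (h ^+ 2 * l * Num.sqrt T%:R))^-1 <= bias T.
Proof.
move=> l2 hl1 qE T8 hT etaT eta2 decT.
have [h0 h1] := andP h_bounds; have [g0 g1] := andP gamma_bounds.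
have [q0 q1] := andP q_bounds.
have /andP[e0 e1] := eta_bounds T.
have [n [nT Tn n2T]] := quarter_split T8.
have T0 : 0 < T%:R :> R by rewrite ltr0n; apply: leq_trans T8.
have nR : T%:R / 4 <= n%:R :> R.
  by have : T%:R <= (n + n + (n + n))%:R :> R; [rewrite ler_nat | rewrite !natrD; lra].
(* T - 2n >= T/2 - 2, which is at least T/4 once T >= 8. *)
have kR : T%:R / 4 <= (T - (n + n))%:R :> R.
  rewrite natrB // natrD.
  have : (n + n + (n + n))%:R <= (T + 4)%:R :> R by rewrite ler_nat.
  have : 8 <= T%:R :> R by rewrite ler_nat.
  by rewrite !natrD; lra.
have l0 : 0 < l by lra.
have hl0 : 0 < h * l by rewrite mulr_gt0.
have eT : 1 / (2 * (h * l)) <= T%:R * eta T.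
  by rewrite ler_pdivrMr; [lra | rewrite mulr_gt0].
have eT' : 1 / 2 <= T%:R * eta T.
  by apply: le_trans eT; rewrite ler_pdivlMr; [lra | rewrite mulr_gt0].
(* Four windows of length [n] cover [T], so the fourth power of [decay h eta n] is at most 1/16. *)
have dn : decay h eta n <= 1 / 2.
  have h01 : 0 <= h <= 1 by apply/andP; split; lra.
  have e01 i : 0 <= eta i <= 1 by case/andP: (eta_bounds i) => /ltW -> ->.
  have := decay_antitone h01 e01 nT.
  have /andP[dn0 _] := decay01 n.
  have := decay_supermul (n + n) (n + n) h01 e01 eta_antitone.
  have := decay_supermul n n h01 e01 eta_antitone.
  set d2 := decay h eta (n + n); set d1 := decay h eta n in dn0 *.
  move=> D1 D2 D3; rewrite leNgt; apply/negP => D4.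
  have D5 : 1 / 4 < d2.
    by apply: lt_le_trans D1; rewrite [ltLHS](_ : _ = 1 / 2 * (1 / 2)); [rewrite ltr_pM | field].
  have D6 : 1 / 4 * (1 / 4) < d2 * d2 by rewrite ltr_pM.
  by lra.
have nT1 : 1 / 8 <= n%:R * eta T.
  apply: (@le_trans _ _ (T%:R / 4 * eta T)); first by lra.
  by rewrite ler_wpM2r // ltW.
have [rho rhoE] : exists rho, rho = 1 - gamma * (1 - 2 * q) by eexists.
(* The choice of [q] makes [rho], the inverse horizon of the bias, comparable to [h * l]. *)
have rho_lo : 3 / 16 * (h * l) <= rho.
  have -> : rho = h + 2 * gamma * q by rewrite rhoE /h; ring.
  have : 3 / 4 * q <= gamma * q by rewrite ler_wpM2r // ltW.
  by rewrite qE; lra.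
have rho_hi : rho <= h * l.
  have -> : rho = h + 2 * gamma * q by rewrite rhoE /h; ring.
  have : gamma * q <= 1 * q by rewrite ler_wpM2r // ltW.
  have : h * 2 <= h * l by rewrite ler_wpM2l // ltW.
  by rewrite qE; lra.
have c0 : 9 / 16 <= gamma * (1 - 2 * q).
  by apply: (@le_trans _ _ (3 / 4 * (3 / 4))); [lra | apply: ler_pM; lra].
have QE : Q = l / (8 * h) by rewrite /Q qE; field; lra.
have rho0 : 0 < rho by lra.
have := @drift_level_ge R h l (eta T) T%:R _ rho h0 l2 e0 T0 hT etaT c0 rho0 rho_hi.
move=> /le_trans; apply; apply: (bias_relax rhoE) n2T _ _.
- by apply/andP; split; lra.
- apply: divr_ge0; last by do 2![apply: mulr_ge0; first exact: ler0n]; exact: sqrtr_ge0.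
  by rewrite ltW // mulr_gt0 // divr_gt0 // mulr_gt0.
- move=> t nt; have et : eta t <= 2 * eta T.
    by apply: eta2; case/andP: nt => nt _; apply: leq_trans nT (leq_add nt nt).
  have := expect_abs_gap_lower dn nT1 nt et; rewrite QE; apply: le_trans.
  set W := Num.sqrt _.
  rewrite le_eqVlt; apply/orP; left; apply/eqP.
  by rewrite !invfM; move: (W^-1) => iW; field; lra.
have k1 : T%:R / 4 * eta T <= (T - (n + n))%:R * eta T by rewrite ler_wpM2r // ltW.
have k2 : 1 / (8 * (h * l)) <= (T - (n + n))%:R * eta T.
  apply: le_trans k1; have -> : 1 / (8 * (h * l)) = 1 / (2 * (h * l)) / 4 by field; lra.
  by lra.
have -> : 3 / 128 = 1 / (8 * (h * l)) * (3 / 16 * (h * l)) by field; lra.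
have p0 : 0 <= 1 / (8 * (h * l)) by apply: divr_ge0 => //; rewrite mulr_ge0 // ltW.
have p1 : 0 <= 3 / 16 * (h * l) by lra.
by rewrite [leRHS]mulrA; apply: ler_pM.
Qed.

(** * Mean squared errors at states 3 and 1 *)

Lemma fork_mse_state3 Qstar : bellman_opt P fork_reward gamma Qstar ->
  (decay h eta T / h) ^+ 2 <= max_mse P fork_reward gamma eta T Qstar.
Proof.
have [h0 h1] := andP h_bounds; have [q0 q1] := andP q_bounds => bQ.
have q12 : 0 <= q <= 1 / 2 by apply/andP; split; lra.
have g01 : 0 < gamma < 1 by case/andP: gamma_bounds => g0 g1; apply/andP; split; lra.
have [_ Q3] := fork_bellman_unique q12 g01 bQ.
apply: (le_trans _ (le_smax _ s3)).
rewrite -(expect_cst kerP T (_ ^+ 2)); apply: expect_le => // w fw.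
have [_ V3 _] := V_feasible (leqnn T) fw; rewrite /V /Qt in V3; rewrite V3 Q3 -/h /v.
by rewrite le_eqVlt; apply/orP; left; apply/eqP; field; rewrite gt_eqF.
Qed.

(** The zero initialization leaves a deficit [decay h eta T / (2 * h)] at state 1, which the bias
    must first overcome. *)
Lemma fork_mse_state1 Qstar (x : R) : bellman_opt P fork_reward gamma Qstar ->
  0 <= x -> x <= bias T - decay h eta T / (2 * h) ->
  x ^+ 2 <= max_mse P fork_reward gamma eta T Qstar.
Proof.
have [h0 h1] := andP h_bounds; have [q0 q1] := andP q_bounds => bQ x0 xle.
have q12 : 0 <= q <= 1 / 2 by apply/andP; split; lra.
have g01 : 0 < gamma < 1 by case/andP: gamma_bounds => g0 g1; apply/andP; split; lra.
have [Q1 _] := fork_bellman_unique q12 g01 bQ.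
apply: (le_trans _ (le_smax _ s1)); rewrite /= Q1 -/h.
apply: le_trans (expect_sqr_ge kerP (fun w => V w T s1) _).
have VT : x <= expect P (fun w => V w T s1) - 1 / (2 * h).
  have : expect P (fun w => mid w T) <= expect P (fun w => V w T s1).
    by apply: expect_le => // w _; rewrite V_mid_gap lerDl divr_ge0.
  move: xle; rewrite /bias /v.
  have -> : (1 - decay h eta T) / h / 2 = 1 / (2 * h) - decay h eta T / (2 * h).
    by field; rewrite gt_eqF.
  by lra.
by rewrite lerXn2r // nnegrE //; exact: le_trans VT.
Qed.

(** The case where state 3 has nearly converged: the deficit is at most eps / 2, against a bias of
    at least 2 eps. *)
Lemma fork_mse_ge Qstar (l eps : R) : bellman_opt P fork_reward gamma Qstar ->
  2 <= l -> h * l <= 1 -> q = h * l / 8 ->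
  (8 <= T)%N -> 1 <= h ^+ 2 * T%:R ->
  1 <= 2 * eta T * h * T%:R * l ->
  (forall t, (T <= t + t)%N -> eta t <= 2 * eta T) ->
  0 <= eps -> decay h eta T <= eps * h -> eps * h <= 1 / 16 ->
  2 * eps <= (2 ^+ 26 * (h ^+ 2 * l * Num.sqrt T%:R))^-1 ->
  eps ^+ 2 <= max_mse P fork_reward gamma eta T Qstar.
Proof.
move=> bQ l2 hl qE T8 hT eT eta2 eps0 dec eps1 eps2.
have [h0 h1] := andP h_bounds.
apply: fork_mse_state1 => //.
have := bias_lower l2 hl qE T8 hT eT eta2 (le_trans dec eps1).
have : decay h eta T / (2 * h) <= eps / 2.
  by rewrite ler_pdivrMr ?mulr_gt0 //; lra.
by move=> A B; have := le_trans eps2 B; lra.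
Qed.

End Paths.
End Instance.

(** * Admissible learning rates *)

Section Rates.
Variable R : realType.

(** Bernoulli's inequality. *)
Lemma decay_const_ge (h e : R) t : 0 <= h -> 0 <= e -> h * e <= 1 ->
  1 - h * e * t%:R <= decay h (fun=> e) t.
Proof.
move=> h0 e0 he; elim: t => [|t IH]; first by rewrite decay0 mulr0 subr0.
rewrite decayS -natr1.
have t0 : 0 <= t%:R :> R by [].
have x0 : 0 <= h * e by rewrite mulr_ge0.
set x := h * e in he x0 IH *; have y0 : 0 <= 1 - x by lra.
have := ler_wpM2r y0 IH; apply: le_trans.
by have := mulr_ge0 (mulr_ge0 x0 x0) t0; lra.
Qed.

Lemma ln2_bounds : 1 / 2 <= ln (2 : R) <= 1.
Proof.
have := @le_ln1Dx R (- (1 / 2)); have -> : 1 - 1 / 2 = 2^-1 :> R by field.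
rewrite lnV ?posrE // => H1; have := @le_ln1Dx R 1; have -> : 1 + 1 = 2 :> R by [].
by move=> H2; apply/andP; split; [have := H1 _ | apply: H2]; lra.
Qed.

(** Splitting 1/h as 4 times 1/(4h) before linearizing the logarithm gives 3h + 1/4 <= 1 for the
    second bound. *)
Lemma log_scale_bounds (h : R) : 0 < h <= 1 / 4 -> 3 <= 2 + ln h^-1 /\ h * (2 + ln h^-1) <= 1.
Proof.
move=> /andP[h0 h1]; have /andP[l0 l1] := ln2_bounds.
have E : ln h^-1 = 2 * ln 2 + ln (4 * h)^-1.
  have -> : h^-1 = 2 * 2 * (4 * h)^-1 by field; lra.
  by rewrite !lnM ?posrE ?mulr_gt0 ?invr_gt0 ?mulr_gt0 //; ring.
have i1 : 1 <= (4 * h)^-1 by rewrite -[leLHS]invr1 lef_pV2 ?posrE //; lra.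
split; first by have := ln_ge0 i1; lra.
have := @le_ln1Dx R ((4 * h)^-1 - 1); rewrite [1 + _]addrC subrK => H.
have {}H : ln (4 * h)^-1 <= (4 * h)^-1 - 1 by apply: H; lra.
have : h * ln h^-1 <= h * (2 + ((4 * h)^-1 - 1)) by apply: ler_wpM2l; lra.
have -> : h * (2 + ((4 * h)^-1 - 1)) = h + 1 / 4 by field; lra.
by lra.
Qed.

(** Taking logarithms in 16 <= h^2 t and using 4 ln 2 >= 2; this fixes the constant 16. *)
Lemma log_scale_le (h t : R) : 0 < h -> 16 <= h ^+ 2 * t -> 2 + ln h^-1 <= ln t - ln h^-1.
Proof.
move=> h0 ht; have /andP[l0 _] := ln2_bounds.
have t0 : 0 < t by rewrite -(pmulr_rgt0 _ (exprn_gt0 2 h0)); lra.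
have A0 : 0 < h ^+ 2 * t by lra.
have : ln 16 <= ln (h ^+ 2 * t) by rewrite ler_ln ?posrE.
have -> : 16 = 2 ^+ 4 :> R by rewrite !exprS expr0; ring.
rewrite lnXn // lnM ?posrE ?exprn_gt0 // lnXn // lnV ?posrE // -[ln h *+ 2]mulr_natr -[ln 2 *+ 4]mulr_natr.
by lra.
Qed.

(** Large [c] makes the rates too small: the decay is at least (1 + l h T)^(-4/(3l)), and l >= 3
    brings the exponent of h sqrt T down to at most 8/9. *)
Lemma decay_linear_large (h c : R) T : 0 < h <= 1 / 4 -> 16 <= h ^+ 2 * T%:R ->
  2 + ln h^-1 <= c ->
  (2 ^+ 27 * (h * Num.sqrt T%:R))^-1 <= decay h (fun t => 1 / (1 + c * h * t%:R)) T.
Proof.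
move=> hb hT lc; have [l3 hl1] := log_scale_bounds hb.
have /andP[l0 l1] := ln2_bounds; have /andP[h0 h1] := hb.
set l := 2 + ln h^-1 in l3 hl1 lc.
have lb : 0 < l <= c by apply/andP; split => //; lra.
apply: le_trans (decay_linear_ge T hb lb).
have T0 : 0 < T%:R :> R by rewrite -(pmulr_rgt0 _ (exprn_gt0 2 h0)); lra.
have T1 : 1 <= T%:R :> R by rewrite ler1n -(@ltr0n R).
set s := Num.sqrt T%:R; have s0 : 0 < s by rewrite sqrtr_gt0.
have s2 : s ^+ 2 = T%:R by rewrite sqr_sqrtr // ltW.
have lnT : ln T%:R = 2 * ln (h * s) + 2 * (l - 2).
  by rewrite -s2 lnXn // lnM ?posrE // /l lnV ?posrE // -[_ *+ 2]mulr_natr; ring.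
have hs0 : 0 < h * s by rewrite mulr_gt0.
have hs4 : 4 <= h * s.
  rewrite -(@ler_pXn2r R 2) ?nnegrE //; last exact: ltW.
  by rewrite exprMn s2; apply: le_trans hT; rewrite expr2; lra.
have lnhs : 0 <= ln (h * s) by apply: ln_ge0; lra.
have arg : ln (1 + l * h * T%:R) <= 2 * ln (h * s) + 2 * l.
  have : ln (1 + l * h * T%:R) <= ln (2 * T%:R).
    have lh : l * h * T%:R <= 1 * T%:R by rewrite ler_wpM2r // mulrC.
    have lh0 : 0 <= l * h * T%:R by rewrite mulr_ge0 // mulr_ge0 //; lra.
    by rewrite ler_ln ?posrE; lra.
  by rewrite lnM ?posrE // lnT; lra.
have e3 : 4 / 3 / l * ln (1 + l * h * T%:R) <= ln (h * s) + 8 / 3.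
  have c0 : 0 <= 4 / 3 / l by apply: divr_ge0; lra.
  apply: le_trans (ler_wpM2l c0 arg) _.
  have -> : 4 / 3 / l * (2 * ln (h * s) + 2 * l) = 8 / (3 * l) * ln (h * s) + 8 / 3.
    by field; lra.
  rewrite lerD2r -[leRHS]mul1r ler_wpM2r // ler_pdivrMr; lra.
apply: (@le_trans _ _ (expR (- (ln (h * s) + 8 / 3)))); last by rewrite ler_expR lerN2.
rewrite expRN lef_pV2 ?posrE ?expR_gt0 ?mulr_gt0 ?exprn_gt0 //.
rewrite expRD lnK ?posrE // mulrC ler_wpM2r //; first exact: ltW.
rewrite -[leRHS]lnK ?posrE ?exprn_gt0 // ler_expR lnXn // -[_ *+ 27]mulr_natr; lra.
Qed.

(** [eps] is the square root of the claimed lower bound; [l <= ln t] trades the scale of the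
    instance for the logarithm of the horizon. *)
Lemma target_level (K h l t : R) : 2 <= K -> 0 < h -> 2 <= l -> l <= ln t ->
  0 < t -> 16 <= h ^+ 2 * t ->
  exists eps, [/\ 0 < eps, ((2 * K)^-1) ^+ 2 / (h ^+ 4 * t * ln t ^+ 2) = eps ^+ 2,
    eps * h <= (2 * K * (h * Num.sqrt t))^-1, eps * h <= 1 / 16 &
    2 * eps <= (K * (h ^+ 2 * l * Num.sqrt t))^-1].
Proof.
move=> K2 h0 l2; have K0 : 0 < K by lra.
move: (ln t) => L lL t0 ht.
have L0 : 0 < L by lra.
have [s [s0 s2]] : exists s, 0 < s /\ s ^+ 2 = t.
  by exists (Num.sqrt t); rewrite sqrtr_gt0 sqr_sqrtr // ltW.
have -> : Num.sqrt t = s by rewrite -s2 sqrtr_sqr gtr0_norm.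
have hs0 : 0 < h * s by rewrite mulr_gt0.
have hs4 : 4 <= h * s.
  rewrite -(@ler_pXn2r R 2) ?nnegrE //; last exact: ltW.
  by rewrite exprMn s2; apply: le_trans ht; rewrite expr2; lra.
have den0 : 0 < 2 * K * (h * s) by apply: mulr_gt0 => //; lra.
have h2 : 0 < h ^+ 2 by rewrite exprn_gt0.
have epsh : (2 * K * (h ^+ 2 * L * s))^-1 * h = (2 * K * (h * s))^-1 / L.
  by field; rewrite !gt_eqF.
have i0 : 0 < (2 * K * (h * s))^-1 by rewrite invr_gt0.
have epsle : (2 * K * (h * s))^-1 / L <= (2 * K * (h * s))^-1.
  by rewrite ler_pdivrMr // ler_peMr //; [exact: ltW | lra].
exists (2 * K * (h ^+ 2 * L * s))^-1; rewrite epsh; split=> //.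
- rewrite invr_gt0; apply: mulr_gt0; first lra.
  by apply: mulr_gt0 => //; exact: mulr_gt0.
- by rewrite -s2; field; rewrite !gt_eqF.
- apply: le_trans epsle _; rewrite div1r lef_pV2 ?posrE //.
  have -> : 16 = 4 * 4 :> R by ring.
  by apply: ler_pM => //; lra.
have -> : 2 * (2 * K * (h ^+ 2 * L * s))^-1 = (K * (h ^+ 2 * L * s))^-1.
  by field; rewrite !gt_eqF.
have l0 : 0 < l by lra.
have hl0 : 0 < h ^+ 2 * l * s by apply: mulr_gt0 => //; exact: mulr_gt0.
have hL0 : 0 < h ^+ 2 * L * s by apply: mulr_gt0 => //; exact: mulr_gt0.
rewrite lef_pV2 ?posrE; [|exact: mulr_gt0|exact: mulr_gt0].
by rewrite ler_pM2l // ler_pM2r // ler_pM2l.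
Qed.

End Rates.

Theorem theorem3 (R : realType) :
  exists c3 : R, exists clb : R, 0 < c3 /\ 0 < clb /\
  forall (gamma : R), 3 / 4 <= gamma -> gamma < 1 ->
  forall T : nat, c3 / (1 - gamma) ^+ 2 <= T%:R ->
  exists (P : St -> Act -> St -> R) (r : St -> Act -> R),
    is_kernel P /\ rewards_in_01 r /\
    (exists Qstar, bellman_opt P r gamma Qstar) /\
    forall Qstar, bellman_opt P r gamma Qstar ->
      (forall c_eta : R, 0 < c_eta ->
         clb / ((1 - gamma) ^+ 4 * T%:R * (ln (T%:R : R)) ^+ 2)
           <= max_mse P r gamma
                (fun t : nat => 1 / (1 + c_eta * (1 - gamma) * t%:R)) T Qstar) /\
      (forall eta : R, 0 < eta -> eta < 1 ->
         clb / ((1 - gamma) ^+ 4 * T%:R * (ln (T%:R : R)) ^+ 2)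
           <= max_mse P r gamma (fun _ : nat => eta) T Qstar).
Proof.
(* The 2^26 comes from [bias_lower]; the extra 2 leaves room for the deficit of state 1. *)
exists 16, ((2 * 2 ^+ 26)^-1 ^+ 2); split; first by []; split.
  by rewrite exprn_gt0 // invr_gt0 mulr_gt0 // exprn_gt0.
move=> gamma g34 g1 T hT'.
have gb : 3 / 4 <= gamma < 1 by rewrite g34 g1.
have hb : 0 < 1 - gamma <= 1 / 4 by apply/andP; split; lra.
have [l3 hl1] := log_scale_bounds hb.
have [h0 h1] := andP hb.
have hT : 16 <= (1 - gamma) ^+ 2 * T%:R.
  by move: hT'; rewrite ler_pdivrMr ?exprn_gt0 // mulrC.
have lnT0 := log_scale_le h0 hT.
have large := fun c => @decay_linear_large R (1 - gamma) c T hb hT.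
have lnTl : 2 + ln (1 - gamma)^-1 <= ln T%:R by lra.
move: (2 + ln (1 - gamma)^-1) l3 hl1 lnTl large => l l3 hl1 lnTl large.
have l2 : 2 <= l by lra.
have hl0 : 0 < (1 - gamma) * l by apply: mulr_gt0; lra.
have [q qE] : exists q, q = (1 - gamma) * l / 8 by eexists.
have qb : 0 < q <= 1 / 8 by apply/andP; split; lra.
have q12 : 0 <= q <= 1 / 2 by apply/andP; split; lra.
have T0 : 0 < T%:R :> R by rewrite -(pmulr_rgt0 _ (exprn_gt0 2 h0)); lra.
have T16 : 16 <= T%:R :> R.
  by apply: le_trans hT _; rewrite ler_piMl // expr_le1 //; lra.
have T8 : (8 <= T)%N by rewrite -(@ler_nat R); lra.
have K2 : 2 <= 2 ^+ 26 :> R by rewrite exprS ler_peMr // exprn_ege1 // ler1n.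
have [eps [eps0 target epsh eps16 eps2]] := target_level K2 h0 l2 lnTl T0 hT.
clear K2; rewrite -exprS in epsh.
have hT1 : 1 <= (1 - gamma) ^+ 2 * T%:R by lra.
have hTge : 1 <= (1 - gamma) * T%:R.
  apply: le_trans hT1 _; rewrite ler_wpM2r // expr2 ler_piMl //; lra.
exists (fork_kernel q), (@fork_reward R); split; first exact: fork_kernelP.
split; first exact: fork_reward01.
split; first by exists (fun s _ => fork_value gamma s); exact: fork_bellman.
move=> Qstar bQ; rewrite target.
(* Settles every rate whose decay is still at least [eps * (1 - gamma)]; both cases below then
   assume the opposite. *)
have state3 eta : (forall t, 0 < eta t <= 1) -> eps * (1 - gamma) <= decay (1 - gamma) eta T ->
    eps ^+ 2 <= max_mse (fork_kernel q) (@fork_reward R) gamma eta T Qstar.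
  move=> eb big; apply: le_trans (fork_mse_state3 gb qb eb T bQ).
  have le : eps <= decay (1 - gamma) eta T / (1 - gamma) by rewrite ler_pdivlMr.
  by rewrite lerXn2r // nnegrE; [exact: ltW | exact: le_trans (ltW eps0) le].
split=> [c c0|e e0 e1]; last first.
  have eb (t : nat) : 0 < e <= 1 by rewrite e0 ltW.
  have [|small] := leP (eps * (1 - gamma)) (decay (1 - gamma) (fun=> e) T); first exact: state3.
  apply: (fork_mse_ge gb qb eb _ _ bQ l2 hl1) => //; try exact: ltW.
  - by clear eb => _; rewrite ler_piMl //; [exact: ltW | lra].
  - clear eb; have he1 : (1 - gamma) * e <= 1 by apply: mulr_ile1; lra.
    have D := decay_const_ge T (ltW h0) (ltW e0) he1.
    (* The decay is below 1/16, so Bernoulli's bound forces h e T > 15/16. *)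
    have X : 1 / 2 <= (1 - gamma) * e * T%:R by lra.
    have -> : 2 * e * (1 - gamma) * T%:R * l = 2 * ((1 - gamma) * e * T%:R) * l by ring.
    have : 1 * 1 <= 2 * ((1 - gamma) * e * T%:R) * l by rewrite ler_pM //; lra.
    by rewrite mulr1.
  - by clear eb => _ _; lra.
set eta := fun t : nat => _.
have ch0 : 0 < c * (1 - gamma) by rewrite mulr_gt0.
have den (t : nat) : 1 <= 1 + c * (1 - gamma) * t%:R by rewrite lerDl mulr_ge0 // ltW.
have den0 (t : nat) : 0 < 1 + c * (1 - gamma) * t%:R by apply: lt_le_trans (den t).
have eb t : 0 < eta t <= 1 by rewrite /eta div1r invr_gt0 den0 invf_le1 ?den.
have [|small] := leP (eps * (1 - gamma)) (decay (1 - gamma) eta T); first exact: state3.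
(* A larger [c] would keep the decay above [eps * (1 - gamma)], against [small]. *)
have cl : c <= l.
  rewrite leNgt; apply/negP => /ltW /large /(le_trans epsh); rewrite -/eta.
  by rewrite leNgt small.
have ch1 : c * (1 - gamma) <= 1.
  by apply: le_trans hl1; rewrite mulrC ler_wpM2l // ltW.
apply: (fork_mse_ge gb qb eb _ _ bQ l2 hl1) => //; try exact: ltW.
(* This is [eta_slow], where [ch1] gives x - 1 <= y for consecutive denominators y and x. *)
- move=> t; rewrite /eta -natr1.
  have x0 := den0 t.+1; have y0 := den0 t; rewrite -natr1 in x0.
  set x := 1 + c * (1 - gamma) * (t%:R + 1) in x0 *; set y := 1 + _ in y0 *.
  have xy : x - 1 <= y by rewrite /x /y; lra.
  have -> : (1 - 1 / x) * (1 / y) = (x - 1) / y * (1 / x) by field; rewrite !gt_eqF.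
  rewrite ler_piMl //; first by rewrite div1r invr_ge0 ltW.
  by rewrite ler_pdivrMr // mul1r.
- move=> i j ij; rewrite /eta !div1r lef_pV2 ?posrE // lerD2l ler_wpM2l ?ler_nat //.
  exact: ltW.
- have -> : 2 * eta T * (1 - gamma) * T%:R * l =
      2 * (l * ((1 - gamma) * T%:R)) / (1 + c * (1 - gamma) * T%:R).
    by rewrite /eta; field; rewrite gt_eqF.
  rewrite ler_pdivlMr // mul1r -mulrA.
  have A : c * ((1 - gamma) * T%:R) <= l * ((1 - gamma) * T%:R).
    by rewrite ler_wpM2r // mulr_ge0 // ltW.
  have B : 1 * 1 <= l * ((1 - gamma) * T%:R) by rewrite ler_pM //; lra.
  by lra.
move=> t Tt; rewrite /eta !div1r -[leLHS]mul1r ler_pdivrMr // mulrAC ler_pdivlMr // mul1r.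
have : T%:R <= t%:R + t%:R :> R by rewrite -natrD ler_nat.
by move=> /(ler_wpM2l (ltW ch0)); lra.
Qed.
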